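(* Let $H_C\subseteq\mathfrak g_C$ be a type C Hessenberg space and let $H\subseteq\mathfrak{sl}_{2n}(\mathbb C)$ be the subspace constructed from it as described in the context. Then: (1) $H$ is a type A Hessenberg space, i.e. $[\mathfrak b,H]\subseteq H$, and $H^\sigma=H_C$; (2) for every $x\in\mathfrak g_C$, $\phi'(\mathcal B_C(x,H_C))=\mathcal B_A(x,H)^\sigma$.
   Context: Let $J$ be the $n\times n$ antidiagonal matrix of $1$'s and $E=\begin{bmatrix}0&J\\-J&0\end{bmatrix}$. Let $\sigma$ be the involution of $SL_{2n}(\mathbb C)$, $\sigma(A)=E(A^{\mathsf{tr}})^{-1}E^{-1}$, and also its differential on $\mathfrak{sl}_{2n}(\mathbb C)$, $\sigma(x)=Ex^{\mathsf{tr}}E$. Set $G_C=SL_{2n}(\mathbb C)^\sigma\cong Sp_{2n}(\mathbb C)$ and $\mathfrak g_C=\mathfrak{sl}_{2n}(\mathbb C)^\sigma$. Let $B$ (resp. $T$) be upper triangular (resp. diagonal) matrices in $SL_{2n}(\mathbb C)$, with Lie algebras $\mathfrak b$, $\mathfrak h$; $B_C=B^\sigma$, $\mathfrak b_C=\mathfrak b^\sigma$, $\mathfrak h^\sigma=\{\mathrm{diag}(d_1,\dots,d_{2n}):d_i=-d_{2n+1-i}\}$. Write $i'=2n+1-i$ and $h_{ij}=E_{ii}-E_{jj}$. A type A Hessenberg space is a subspace $H\subseteq\mathfrak{sl}_{2n}(\mathbb C)$ with $[\mathfrak b,H]\subseteq H$; a type C Hessenberg space is a subspace $H_C\subseteq\mathfrak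 g_C$ with $[\mathfrak b_C,H_C]\subseteq H_C$. For $i\ne j$, the restriction of $\varepsilon_i-\varepsilon_j$ to $\mathfrak h^\sigma$ is a root of $\mathfrak g_C$ (with respect to $\mathfrak h^\sigma$), and its root space is spanned by $E_{ij}+\sigma(E_{ij})$. Define $\Phi_H$ as the set of $\varepsilon_i-\varepsilon_j$ ($i\neq j$) such that the root space of $\mathfrak g_C$ for $(\varepsilon_i-\varepsilon_j)|_{\mathfrak h^\sigma}$ is contained in $H_C$. Define $H=(H\cap\mathfrak h)\oplus\bigoplus_{\varepsilon_i-\varepsilon_j\in\Phi_H}\mathbb CE_{ij}$, where $H\cap\mathfrak h$ is the span of $H_C\cap\mathfrak h^\sigma$ together with all $h_{ij}$ such that both $\varepsilon_i-\varepsilon_j$ and $\varepsilon_j-\varepsilon_i$ lie in $\Phi_H$. Let $\mathcal B_A=SL_{2n}(\mathbb C)/B$, on which $\sigma$ acts by $gB\mapsto\sigma(g)B$, and $\mathcal B_C=G_C/B_C$; $\phi':\mathcal B_C\to\mathcal B_A$, $gB_C\mapsto gB$. Adjoint Hessenberg varieties: $\mathcal B_A(x,H)=\{gB:g^{-1}xg\in H\}$, $\mathcal B_C(x,H_C)=\{gB_C: g\in G_C,\ g^{-1}xg\in H_C\}$. *)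

(* Defs.v *)
(* The complex numbers are modelled as  C := R[i]  (the
   real_closed library's  complex R) for an arbitrary  R : realType, i.e. a
   model of the real numbers; ℂ is the case of the (unique up to iso) reals. *)
From HB Require Import structures.
From mathcomp Require Import all_boot all_order all_algebra.
From mathcomp Require Import reals complex.
Set Implicit Arguments.
Unset Strict Implicit.
Unset Printing Implicit Defensive.
Import Order.TTheory GRing.Theory Num.Theory.
Local Open Scope ring_scope.

Section Defs.
Variables (R : realType) (n : nat).
Local Notation C := (R[i]).
(* the size 2n of the matrices; indices 'I_(n + n) are 0-based, so the
   paper's i' = 2n+1-i becomes  (n + n).-1 - i *)
Local Notation N := (n + n)%N.
Local Notation M := ('M[C]_N).

Definition Jmx : 'M[C]_n := \matrix_(i < n, j < n) ((i + j)%N == n.-1)%:R.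

Definition Emx : M := block_mx 0 Jmx (- Jmx) 0.

Definition sigmaG (A : M) : M := Emx *m invmx (A^T) *m invmx Emx.

(* its differential on sl_{2n}:  sigma(x) = E x^T E *)
Definition sigmaL (x : M) : M := Emx *m x^T *m Emx.

Definition SL (g : M) : Prop := \det g = 1.
Definition sl (x : M) : Prop := \tr x = 0.

Definition upper (x : M) : Prop := forall i j : 'I_N, (j < i)%N -> x i j = 0.
Definition diag (x : M) : Prop := forall i j : 'I_N, i != j -> x i j = 0.

Definition Bor (g : M) : Prop := SL g /\ upper g.
Definition bor (x : M) : Prop := sl x /\ upper x.
Definition cart (x : M) : Prop := sl x /\ diag x.

Definition GC (g : M) : Prop := SL g /\ sigmaG g = g.
Definition gC (x : M) : Prop := sl x /\ sigmaL x = x.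
Definition BC (g : M) : Prop := Bor g /\ sigmaG g = g.
Definition borC (x : M) : Prop := bor x /\ sigmaL x = x.

(* h^sigma = { diag(d_1..d_2n) : d_i = - d_{i'} } *)
Definition primeI (i : 'I_N) : 'I_N := rev_ord i.
Definition cartsig (x : M) : Prop :=
  diag x /\ forall i : 'I_N, x i i = - x (primeI i) (primeI i).

Definition subspace (P : M -> Prop) : Prop :=
  P 0 /\ (forall x y, P x -> P y -> P (x + y))
      /\ (forall (c : C) x, P x -> P (c *: x)).

Definition bracket (x y : M) : M := x *m y - y *m x.

Definition hessA (H : M -> Prop) : Prop :=
  subspace H /\ (forall x, H x -> sl x) /\
  (forall y x, bor y -> H x -> H (bracket y x)).

Definition hessC (HC : M -> Prop) : Prop :=
  subspace HC /\ (forall x, HC x -> gC x) /\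
  (forall y x, borC y -> HC x -> HC (bracket y x)).

(* root space of g_C (w.r.t. h^sigma) for the root (eps_i - eps_j)|_{h^sigma} *)
Definition rootspaceC (i j : 'I_N) (x : M) : Prop :=
  gC x /\ forall h, cartsig h -> bracket h x = (h i i - h j j) *: x.

Definition PhiH (HC : M -> Prop) (i j : 'I_N) : Prop :=
  i != j /\ forall x, rootspaceC i j x -> HC x.

Definition hmx (i j : 'I_N) : M := delta_mx i i - delta_mx j j.

Definition Hcart (HC : M -> Prop) (d : M) : Prop :=
  exists (d0 : M) (c : 'I_N -> 'I_N -> C),
    (HC d0 /\ cartsig d0) /\
    (forall i j, ~ (PhiH HC i j /\ PhiH HC j i) -> c i j = 0) /\
    d = d0 + \sum_(i < N) \sum_(j < N) c i j *: hmx i j.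

Definition Hof (HC : M -> Prop) (x : M) : Prop :=
  exists (d : M) (c : 'I_N -> 'I_N -> C),
    Hcart HC d /\
    (forall i j, ~ PhiH HC i j -> c i j = 0) /\
    x = d + \sum_(i < N) \sum_(j < N) c i j *: delta_mx i j.

(* the point gB of B_A = SL/B lies in B_A(x, H) :
   gB = g'B for some g' in SL with g'^{-1} x g' in H *)
Definition in_BA (x : M) (H : M -> Prop) (g : M) : Prop :=
  exists g' : M, SL g' /\ Bor (invmx g' *m g) /\ H (invmx g' *m x *m g').

(* gB is fixed by sigma: sigma(g)B = gB *)
Definition sigma_fixed (g : M) : Prop := Bor (invmx g *m sigmaG g).

(* gB lies in phi'(B_C(x, H_C)) : gB = kB for some k in G_C with
   k^{-1} x k in H_C *)
Definition in_phiBC (x : M) (HC : M -> Prop) (g : M) : Prop :=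
  exists k : M, GC k /\ HC (invmx k *m x *m k) /\ Bor (invmx k *m g).

End Defs.

(* Main.v *)
Require Import Defs.
From HB Require Import structures.
From mathcomp Require Import all_boot all_order all_algebra.
From mathcomp Require Import boolp reals complex.
From mathcomp Require Import ring zify.
Local Open Scope ring_scope.

(* Since H_C is stable under h^sigma it is the sum of its weight spaces, so
   (i, j) lies in Phi_H as soon as some x in H_C has x_ij <> 0.  Brackets of root
   vectors show that Phi_H is stable under moving up or right in the matrix and,
   below the diagonal, under transposition.  This gives [b, H] <= H entrywise,
   and H^sigma = H_C by averaging over sigma.

   For (2), b = g^-1 sigma(g) is upper triangular and b E is skew-symmetric, so
   b = c sigma(c)^-1 for an explicit upper triangular c, and k = g c preserves
   the symplectic form; hence det k = 1 and k lies in G_C.  Finally k^-1 x k lies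
   in H because H is stable under conjugation by B, which is deduced
   algebraically from stability under [b, -]. *)

Import Order.TTheory GRing.Theory Num.Theory.

Set Implicit Arguments.
Unset Strict Implicit.

(** * Conjugation of matrices from closure under brackets *)

Lemma invmx_mul (F : comUnitRingType) m (x y : 'M[F]_m) :
  x \in unitmx -> y \in unitmx -> invmx (x *m y) = invmx y *m invmx x.
Proof.
move=> ux uy; have uxy : x *m y \in unitmx by rewrite unitmx_mul ux.
by rewrite -[RHS](mulmxK uxy) !mulmxA mulmxKV // mulVmx // mul1mx.
Qed.

(** The k-th term is y^(k+1) x y^(m-k) - y^k x y^(m-k+1), so the sum telescopes. *)
Lemma sum_exp_commutator (T : nzRingType) (x y : T) m :
  \sum_(k < m.+1) y ^+ k * (y * x - x * y) * y ^+ (m - k) =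
  y ^+ m.+1 * x - x * y ^+ m.+1.
Proof.
elim: m => [|m IHm]; first by rewrite big_ord1 subnn !expr0 mul1r mulr1 expr1.
rewrite big_ord_recr /= subnn expr0 mulr1.
under eq_bigr => k _ do rewrite subSn ?leq_ord // exprSr mulrA.
rewrite -mulr_suml IHm mulrBl mulrBr -!mulrA -!exprSr !mulrA -exprSr.
by rewrite addrC addrA subrK.
Qed.

(* Newton's identity for the supersymmetric power sums L^k - R^k in the left and
   right multiplications L, R by y expresses (k+1) [y, x] y^k through the
   brackets [y^i, -]. *)
Lemma commutator_mul_exp_closed (F : numFieldType) (m : nat)
    (H : 'M[F]_m.+1 -> Prop) (y : 'M[F]_m.+1) :
  H 0 -> (forall x z, H x -> H z -> H (x + z)) ->
  (forall c x, H x -> H (c *: x)) ->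
  (forall k x, H x -> H (y ^+ k * x - x * y ^+ k)) ->
  forall x, H x -> forall k, H ((y * x - x * y) * y ^+ k).
Proof.
move=> H0 HD HZ Hy x Hx; set D := y * x - x * y.
elim/ltn_ind => k IHk.
(* Summing [y^(i+1), D y^(k-i-1)] over i < k gives all the terms y^j D y^(k-j) with j > 0, minus k
   copies of D y^k. Subtracting this from [y^(k+1), x] leaves (k+1) D y^k, and k+1 is invertible in
   characteristic 0. *)
have -> : D * y ^+ k = k.+1%:R^-1 *: ((y ^+ k.+1 * x - x * y ^+ k.+1)
   - \sum_(i < k) (y ^+ i.+1 * (D * y ^+ (k - i.+1))
                   - D * y ^+ (k - i.+1) * y ^+ i.+1)).
  rewrite -sum_exp_commutator big_ord_recl subn0 expr0 mul1r sumrB.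
  under [X in _ - (_ - X)]eq_bigr => i _ do rewrite -mulrA -exprD subnK //.
  under [X in _ - (X - _)]eq_bigr => i _ do rewrite mulrA.
  rewrite sumr_const card_ord opprB addrACA addrA.
  rewrite [X in X + _ - _]addrC -addrA subrr addr0 -/D.
  by rewrite addrC -mulrS -scaler_nat scalerA mulVf ?scale1r // pnatr_eq0.
apply/HZ/HD; first exact: Hy.
rewrite -scaleN1r; apply/HZ.
elim/big_rec: _ => // i z _ Hz; apply/HD => //; apply/Hy/IHk.
by case: i => i /=; case: k {IHk} => // k _; rewrite subSS ltnS leq_subr.
Qed.

(** Write the characteristic polynomial as q X + p_0 with p_0 = ± det y nonzero; by Cayley-Hamilton,
    - q(y) / p_0 is the inverse of y. *)
Lemma invmx_horner (F : fieldType) m (y : 'M[F]_m.+1) :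
  y \in unitmx -> exists q, invmx y = horner_mx y q.
Proof.
move=> uy; set p := char_poly y; pose q := \poly_(i < size p) p`_i.+1.
have pE : p = q * 'X + (p`_0)%:P.
  apply/polyP => -[|i]; rewrite coefD coefMX coefC ?add0r //= addr0 coef_poly.
  by case: ltnP => // h; rewrite nth_default // ltnW.
have := Cayley_Hamilton y.
rewrite -/p pE rmorphD rmorphM /= horner_mx_X horner_mx_C.
have p0 : p`_0 != 0.
  rewrite char_poly_det mulf_neq0 ?expf_neq0 ?oppr_eq0 ?oner_eq0 //.
  by rewrite -unitfE -unitmxE.
move=> /eqP; rewrite addr_eq0 => /eqP qy.
exists ((- p`_0)^-1 *: q); rewrite horner_mxZ.
apply: (canRL (scalerK _)); first by rewrite oppr_eq0.
rewrite -[RHS](mulmxK uy) (_ : _ *m y = - (p`_0)%:M) //.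
by rewrite mulNmx mul_scalar_mx scaleNr.
Qed.

Lemma invmx_closed (F : fieldType) m (P : 'M[F]_m -> Prop) :
  P 0 -> (forall x z, P x -> P z -> P (x + z)) ->
  (forall c x, P x -> P (c *: x)) ->
  P 1%:M -> (forall y z, P y -> P z -> P (y *m z)) ->
  forall y, y \in unitmx -> P y -> P (invmx y).
Proof.
(* [horner_mx] lives in positive size; in size 0 all matrices are equal. *)
case: m P => [|m] P P0 PD PZ P1 PM y uy Py.
  by rewrite (_ : invmx y = y) //; apply/matrixP => -[].
have [q ->] := invmx_horner uy.
elim/poly_ind: q => [|q c IHq]; first by rewrite rmorph0.
rewrite rmorphD rmorphM /= horner_mx_X horner_mx_C; apply/PD; first exact: PM.
by rewrite -scalemx1; apply: PZ.
Qed.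

(* y x y^-1 = x + [y, x] y^-1, and y^-1 is a polynomial in y. *)
Lemma conj_closed (F : numFieldType) (m : nat) (H P : 'M[F]_m -> Prop) :
  H 0 -> (forall x z, H x -> H z -> H (x + z)) ->
  (forall c x, H x -> H (c *: x)) ->
  P 1%:M -> (forall y z, P y -> P z -> P (y *m z)) ->
  (forall y x, P y -> H x -> H (y *m x - x *m y)) ->
  forall y x, y \in unitmx -> P y -> H x -> H (y *m x *m invmx y).
Proof.
case: m H P => [|m] H P H0 HD HZ P1 PM PH y x uy Py Hx.
  by rewrite (_ : _ *m _ = 0) //; apply/matrixP => -[].
have Pk k : P (y ^+ k) by elim: k => // k IHk; rewrite exprS; apply: PM.
have Hc := commutator_mul_exp_closed H0 HD HZ (fun k w => PH _ w (Pk k)).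
have -> : y *m x *m invmx y = x + (y *m x - x *m y) *m invmx y.
  by rewrite mulmxBl (mulmxK uy) addrC subrK.
apply/HD => //; have [q ->] := invmx_horner uy.
(* The spare factor y^k absorbs the power of y that each step of the induction on [r] produces. *)
suff Hq (r : {poly F}) k : H ((y *m x - x *m y) * (y ^+ k * horner_mx y r)).
  by have := Hq q 0%N; rewrite expr0 mul1r.
elim/poly_ind: r k => [|r c IHr] k; first by rewrite rmorph0 !mulr0.
rewrite rmorphD mulrC rmorphM /= horner_mx_X horner_mx_C mulrDr mulrA -exprSr.
rewrite mulrDr; apply/HD; first exact: IHr.
by rewrite [_ * c%:M]mul_mx_scalar -scalerAr; apply/HZ/Hc.
Qed.

(** * Symplectic matrices have determinant 1 *)

Lemma exists_symmetric_unit (F : fieldType) n (A C : 'M[F]_n) :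
  A^T *m C = C^T *m A ->
  (forall V : 'M[F]_n, A *m V = 0 -> C *m V = 0 -> V = 0) ->
  exists2 X : 'M[F]_n, X^T = X & A + X *m C \in unitmx.
Proof.
move=> sAC kAC.
set L := col_ebase A; set U := row_ebase A; set r := \rank A.
pose p : 'M[F]_n := pid_mx r; pose cp : 'M[F]_n := copid_mx r.
have uL : L \in unitmx by exact: col_ebase_unit.
have uU : U \in unitmx by exact: row_ebase_unit.
have Ae : L *m p *m U = A by exact: mulmx_ebase.
have rn : (r <= n)%N by exact: rank_leq_row.
have pT : p^T = p by rewrite tr_pid_mx.
have cpT : cp^T = cp by rewrite /cp /copid_mx linearB /= trmx1 tr_pid_mx.
have pp : p *m p = p by rewrite /p pid_mx_id.
have pcp : p *m cp = 0 by rewrite /p /cp mul_pid_mx_copid.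
have pDcp : p + cp = 1%:M by rewrite addrC subrK.
clearbody p cp; pose C' := L^T *m C *m invmx U.
have sC : p *m C' = C'^T *m p.
  have uUT : U^T \in unitmx by rewrite unitmx_tr.
  move: sAC; rewrite -Ae !trmx_mul pT => /(congr1 (mulmx (invmx U^T))).
  move=> /(congr1 (mulmx^~ (invmx U))); rewrite -!mulmxA mulKmx // mulmxV // mulmx1.
  by rewrite trmxK trmx_inv !mulmxA.
(* After the rank normal form A = L p U, this [X] turns A + X C into p + cp C', up to units: the
   first r rows come from [p], the others from [C']. *)
exists (L *m cp *m L^T); first by rewrite !trmx_mul trmxK cpT mulmxA.
have -> : A + L *m cp *m L^T *m C = L *m (p + cp *m C') *m U.
  by rewrite mulmxDr mulmxDl Ae -!mulmxA mulVmx // mulmx1.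
(* [kermx] is a left kernel, hence the transpose. The right kernel [V] is killed by [p] and then, by
   [sC], also by [C']; so U^-1 V is killed by A and C. *)
rewrite !unitmx_mul uL uU andbT /= -unitmx_tr -row_free_unit -kermx_eq0.
set K := kermx _; apply/eqP.
have : (p + cp *m C') *m K^T = 0.
  by rewrite -[_ + _]trmxK -trmx_mul mulmx_ker trmx0.
set V := K^T; rewrite mulmxDl => eV.
have pV : p *m V = 0.
  by move: (congr1 (mulmx p) eV); rewrite mulmxDr mulmx0 !mulmxA pp pcp !mul0mx addr0.
have cV : C' *m V = 0.
  rewrite -[C' *m V]mul1mx -pDcp mulmxDl mulmxA sC -mulmxA pV mulmx0 add0r.
  by move: eV; rewrite pV add0r mulmxA.
have : invmx U *m V = 0.
  apply: kAC; first by rewrite -Ae -!mulmxA mulKVmx // pV mulmx0.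
  have uLT : L^T \in unitmx by rewrite unitmx_tr.
  by rewrite -[LHS](mulKmx uLT) (_ : L^T *m _ = C' *m V) ?cV ?mulmx0 // !mulmxA.
move=> /(congr1 (mulmx U)); rewrite mulKVmx // mulmx0 => V0.
by rewrite -[K]trmxK -/V V0 trmx0.
Qed.

(* With k = [[A, B], [C, D]] symplectic and X symmetric,
   [[1, X], [-C^T, A^T]] k = [[A + X C, B + X D], [0, 1]],
   and the outer two matrices have the same determinant det (A + X C). *)
Lemma det_symplectic (F : fieldType) n (k : 'M[F]_(n + n)) :
  let W := block_mx 0 1%:M (- 1%:M) 0 : 'M[F]_(n + n) in
  k^T *m W *m k = W -> \det k = 1.
Proof.
move=> W; rewrite -[k]submxK.
set A := ulsubmx k; set B := ursubmx k; set C := dlsubmx k; set D := drsubmx k.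
rewrite /W tr_block_mx !mulmx_block !(mulmx0, mulmxN, mulmx1, mulNmx, add0r, addr0).
case/eq_block_mx => eAC eAD eDA _.
have sAC : A^T *m C = C^T *m A by apply/eqP; rewrite -subr_eq0 addrC eAC.
(* The relation D^T A - B^T C = 1 excludes a common kernel of A and C. *)
have [V AV CV|X sX uX] := exists_symmetric_unit sAC.
  have /(congr1 (mulmx^~ V)) := eDA.
  rewrite mulmxDl !mulNmx mul1mx -!mulmxA AV CV !mulmx0 oppr0 addr0.
  by move/eqP; rewrite eq_sym oppr_eq0 => /eqP.
have e1 : block_mx 1%:M X (- C^T) A^T *m block_mx A B C D =
    block_mx (A + X *m C) (B + X *m D) 0 1%:M.
  by rewrite mulmx_block !mul1mx !mulNmx eAC eAD.
have e2 : block_mx 1%:M X (- C^T) A^T =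
    block_mx 1%:M 0 (- C^T) 1%:M *m block_mx 1%:M X 0 (A + X *m C)^T.
  rewrite mulmx_block !(mul1mx, mulmx1, mul0mx, mulmx0, addr0) linearD /= trmx_mul sX.
  by rewrite mulNmx addrC addrK.
have := congr1 (@determinant _ _) e1.
rewrite det_mulmx e2 det_mulmx det_lblock !det_ublock !det1 !mul1r mulr1 det_tr.
by rewrite -[RHS]mulr1; apply: mulfI; rewrite -unitfE -unitmxE.
Qed.

(** * The involution in coordinates and its fixed points *)

Section Sigma.
Variables (R : realType) (n : nat).
Local Notation C := (R[i]).
Local Notation N := (n + n)%N.
Local Notation M := ('M[C]_N).
Local Notation E := (Emx R n).
Local Notation J := (Jmx R n).
Implicit Types (x y g : M) (i j k : 'I_N).

Lemma JmxE (i j : 'I_n) : J i j = (j == rev_ord i)%:R.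
Proof.
rewrite mxE -val_eqE /=; congr (nat_of_bool _)%:R.
by apply/eqP/eqP; have := ltn_ord i; have := ltn_ord j; lia.
Qed.

Lemma Jmx_tr : J^T = J.
Proof. by apply/matrixP => i j; rewrite !mxE addnC. Qed.

Lemma JmxK : J *m J = 1%:M.
Proof.
apply/matrixP => i j; rewrite mxE (bigD1 (rev_ord i)) //= big1 ?addr0.
  by rewrite !JmxE eqxx mul1r rev_ordK mxE eq_sym.
by move=> k ki; rewrite JmxE (negbTE ki) mul0r.
Qed.

Lemma Emx_sqr : E *m E = - 1%:M.
Proof.
rewrite mulmx_block !(mul0mx, mulmx0, mulmxN, mulNmx, add0r, addr0) JmxK.
by rewrite (scalar_mx_block _ _ 1) opp_block_mx !oppr0.
Qed.

Lemma Emx_unit : E \in unitmx.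
Proof. by apply: (@mulmx1_unit _ _ _ (- E) _).1; rewrite mulmxN Emx_sqr opprK. Qed.

Lemma Emx_inv : invmx E = - E.
Proof. by rewrite -[RHS](mulKmx Emx_unit) mulmxN Emx_sqr opprK mulmx1. Qed.

Lemma Emx_tr : E^T = - E.
Proof. by rewrite tr_block_mx !trmx0 linearN /= !Jmx_tr opp_block_mx !oppr0 opprK. Qed.

(** The only nonzero entry in row i of [E] is [sgI i], in column i'. *)
Definition sgI (i : 'I_N) : C := (-1) ^+ (n <= i)%N.

Lemma sgI_rev i : sgI (rev_ord i) = - sgI i.
Proof.
have ilt := ltn_ord i; rewrite /sgI /=.
case: leqP => h1; case: leqP => h2;
  by rewrite ?expr0 ?expr1 ?opprK //; lia.
Qed.

Lemma sgI_sqr i : sgI i * sgI i = 1.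
Proof. by rewrite -expr2 sqrr_sign. Qed.

Lemma EmxE i j : E i j = sgI i * (j == rev_ord i)%:R.
Proof.
rewrite /sgI; case: (split_ordP i) => i1 ->; case: (split_ordP j) => j1 -> /=.
- rewrite block_mxEul mxE -val_eqE /= [_ == _]negbTE ?mulr0 //.
  by have := ltn_ord i1; have := ltn_ord j1; lia.
- rewrite block_mxEur JmxE -!val_eqE /= leqNgt ltn_ord /= expr0 mul1r.
  by congr (nat_of_bool _)%:R; apply/eqP/eqP;
    have := ltn_ord i1; have := ltn_ord j1; lia.
- rewrite block_mxEdl mxE JmxE -!val_eqE /= leq_addr /= expr1 mulN1r; congr (- _).
  by congr (nat_of_bool _)%:R; apply/eqP/eqP;
    have := ltn_ord i1; have := ltn_ord j1; lia.
- rewrite block_mxEdr mxE -val_eqE /= [_ == _]negbTE ?mulr0 //.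
  by have := ltn_ord i1; have := ltn_ord j1; lia.
Qed.

(** [E] is a signed permutation matrix, so sigma reflects the entries in the antidiagonal, up to
    signs. *)
Lemma sigmaLE x i j :
  sigmaL x i j = - (sgI i * sgI j * x (rev_ord j) (rev_ord i)).
Proof.
rewrite mxE (bigD1 (rev_ord j)) //= big1 ?addr0 => [|k kj]; last first.
  by rewrite [E k j]EmxE -(inj_eq rev_ord_inj) rev_ordK eq_sym (negbTE kj) !mulr0.
rewrite mxE (bigD1 (rev_ord i)) //= big1 ?addr0 => [|k ki]; last first.
  by rewrite EmxE (negbTE ki) mulr0 mul0r.
by rewrite !EmxE rev_ordK !eqxx !mulr1 mxE sgI_rev; ring.
Qed.

Lemma sigmaLK x : sigmaL (sigmaL x) = x.
Proof.
apply/matrixP => i j; rewrite !sigmaLE !rev_ordK !sgI_rev.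
transitivity ((sgI i * sgI i) * (sgI j * sgI j) * x i j); first by ring.
by rewrite !sgI_sqr !mul1r.
Qed.

Lemma sigmaLD x y : sigmaL (x + y) = sigmaL x + sigmaL y.
Proof. by rewrite /sigmaL linearD /= mulmxDr mulmxDl. Qed.

Lemma sigmaLZ c x : sigmaL (c *: x) = c *: sigmaL x.
Proof. by rewrite /sigmaL linearZ /= -scalemxAr -scalemxAl. Qed.

(** The diagonal entries at i and i' are opposite, so the trace equals its own negative. *)
Lemma sl_of_sigma_fixed x : sigmaL x = x -> sl x.
Proof.
move=> sx; rewrite /sl /mxtrace.
have e : \sum_i x i i = - \sum_i x i i.
  rewrite {1}(reindex_inj rev_ord_inj) /= -sumrN; apply: eq_bigr => i _.
  by rewrite -[in LHS]sx sigmaLE rev_ordK sgI_sqr mul1r.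
have /eqP : (\sum_i x i i) *+ 2 = 0 by rewrite mulr2n {1}e addNr.
by rewrite mulrn_eq0 => /eqP.
Qed.

Lemma sigmaG_fixedP g : g \in unitmx -> sigmaG g = g <-> g *m E *m g^T = E.
Proof.
move=> ug; have ugT : g^T \in unitmx by rewrite unitmx_tr.
rewrite /sigmaG; split => h.
  by rewrite -{1}h mulmxKV ?Emx_unit // mulmxKV.
by rewrite -{1}h mulmxK // mulmxK // Emx_unit.
Qed.

(** Conjugation by diag(1, J) carries [E] to the standard symplectic form. The transpose enters
    because here the form is preserved as g E g^T. *)
Lemma det_of_Emx_fixed g : g *m E *m g^T = E -> \det g = 1.
Proof.
move=> hg; pose D : M := block_mx 1%:M 0 0 J.
have DD : D *m D = 1%:M.
  rewrite mulmx_block !(mul0mx, mulmx0, mul1mx, add0r, addr0) JmxK.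
  by rewrite (scalar_mx_block _ _ 1).
have DT : D^T = D by rewrite tr_block_mx !trmx0 trmx1 Jmx_tr.
pose W : M := block_mx 0 1%:M (- 1%:M) 0.
have detW (k : M) : k^T *m W *m k = W -> \det k = 1 by exact: det_symplectic.
have EW : D *m E *m D = W.
  rewrite /D /Emx /W !mulmx_block.
  by rewrite !(mul0mx, mulmx0, mul1mx, mulmx1, mulmxN, mulNmx, add0r, addr0) JmxK.
clearbody D W.
have WE : D *m W *m D = E.
  by rewrite -EW !mulmxA DD mul1mx -mulmxA DD mulmx1.
have : \det (D *m g *m D)^T = 1.
  apply: detW; rewrite trmxK !trmx_mul DT.
  have -> : D *m g *m D *m W *m (D *m (g^T *m D)) =
      D *m (g *m (D *m W *m D) *m g^T) *m D by rewrite !mulmxA.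
  by rewrite WE hg EW.
by rewrite det_tr !det_mulmx mulrAC -det_mulmx DD det1 mul1r.
Qed.

(** * The Borel subgroup and symplectic representatives of flags *)

Lemma upper_scalar_mx (c : C) : upper (c%:M : M).
Proof. by move=> i j ji; rewrite mxE; case: eqP ji => // ->; rewrite ltnn. Qed.

Lemma upper_add x y : upper x -> upper y -> upper (x + y).
Proof. by move=> ux uy i j ji; rewrite mxE ux ?uy ?addr0. Qed.

Lemma upper_scale c x : upper x -> upper (c *: x).
Proof. by move=> ux i j ji; rewrite mxE ux ?mulr0. Qed.

Lemma upper_mul x y : upper x -> upper y -> upper (x *m y).
Proof.
move=> ux uy i j ji; rewrite mxE big1 // => k _.
case: (ltnP k i) => ki; first by rewrite ux ?mul0r.
by rewrite uy ?mulr0 // (leq_trans ji).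
Qed.

Lemma upper_inv x : x \in unitmx -> upper x -> upper (invmx x).
Proof.
apply: (invmx_closed (P := @upper R n)).
- by move=> i j _; rewrite mxE.
- exact: upper_add.
- exact: upper_scale.
- exact: upper_scalar_mx.
- exact: upper_mul.
Qed.

Lemma upper_sigmaL x : upper x -> upper (sigmaL x).
Proof.
move=> ux i j ji; rewrite sigmaLE ux ?mulr0 ?oppr0 //=.
by have := ltn_ord i; have := ltn_ord j; lia.
Qed.

Lemma SL_unit g : SL g -> g \in unitmx.
Proof. by move=> dg; rewrite unitmxE dg unitr1. Qed.

Lemma Bor_mul x y : Bor x -> Bor y -> Bor (x *m y).
Proof.
move=> [dx ux] [dy uy].
by split; [rewrite /SL det_mulmx dx dy mulr1 | exact: upper_mul].
Qed.

Lemma Bor_inv x : Bor x -> Bor (invmx x).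
Proof.
move=> [dx ux]; split; first by rewrite /SL det_inv dx invr1.
by apply: upper_inv => //; apply: SL_unit.
Qed.

Lemma sigmaGE g : sigmaG g = - sigmaL (invmx g).
Proof. by rewrite /sigmaG Emx_inv mulmxN -trmx_inv. Qed.

Lemma Bor_sigmaG x : Bor x -> Bor (sigmaG x).
Proof.
move=> [dx ux]; split.
  rewrite /SL /sigmaG !det_mulmx !det_inv det_tr dx invr1 mulr1 mulrV //.
  by rewrite -unitmxE Emx_unit.
rewrite sigmaGE -scaleN1r; apply/upper_scale/upper_sigmaL/upper_inv => //.
exact: SL_unit.
Qed.

Lemma sigmaG_mul x y : x \in unitmx -> y \in unitmx ->
  sigmaG (x *m y) = sigmaG x *m sigmaG y.
Proof.
move=> ux uy; rewrite /sigmaG.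
rewrite -[_ *m invmx E *m _]mulmxA -[E *m invmx y^T *m _]mulmxA mulKmx ?Emx_unit //.
by rewrite trmx_mul invmx_mul ?unitmx_tr // !mulmxA.
Qed.

(* If b has blocks [[P, Q], [0, S]], then c = [[P, Q S^-1 / 2], [0, 1]] works. *)
Lemma exists_upper_factor (b : M) : b \in unitmx -> upper b -> E *m b^T = b *m E ->
  exists c : M, [/\ upper c, c \in unitmx & c *m E *m c^T = b *m E].
Proof.
move=> ub tb.
have bE := submxK b.
set P := ulsubmx b in bE; set Q := ursubmx b in bE; set S := drsubmx b in bE.
have b0 : dlsubmx b = 0.
  apply/matrixP => i j; rewrite !mxE tb //=.
  by have := ltn_ord i; have := ltn_ord j; lia.
rewrite b0 in bE.
have /andP [uP uS] : (P \in unitmx) && (S \in unitmx).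
  by move: ub; rewrite -bE !unitmxE det_ublock unitrM.
rewrite -bE tr_block_mx !mulmx_block.
rewrite !(mul0mx, mulmx0, mulmx1, mulmxN, mulNmx, add0r, addr0, trmx0).
case/eq_block_mx => eQ eS eP _.
(* The symmetry of [b *m E] gives J P^T = S J, J S^T = P J and J Q^T = - Q J. With the factor 1/2,
   each of the two terms in [YE] contributes - Q J / 2. *)
pose Y := 2%:R^-1 *: (Q *m invmx S).
have YE : - (Y *m J *m P^T) + P *m J *m Y^T = - (Q *m J).
  have SY : S^T *m Y^T = 2%:R^-1 *: Q^T.
    by rewrite -trmx_mul -scalemxAl mulmxKV // linearZ.
  have PJ : J *m P^T = S *m J by apply: oppr_inj.
  rewrite -eS -[J *m S^T *m _]mulmxA SY -[Y *m J *m P^T]mulmxA PJ mulmxA.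
  rewrite -scalemxAl mulmxKV // -scalemxAr eQ -scalemxAl scalerN -opprD -scalerDl.
  by congr (- _); rewrite -[RHS]scale1r; congr (_ *: _); field.
exists (block_mx P Y 0 1%:M); split.
- move=> i j; case: (split_ordP i) => i1 ->; case: (split_ordP j) => j1 -> /= ji.
  + by rewrite block_mxEul mxE mxE tb.
  + by have := ltn_ord i1; lia.
  + by rewrite block_mxEdl mxE.
  + rewrite block_mxEdr mxE; case: eqP ji => // ->; rewrite ?ltnn //; lia.
- by rewrite unitmxE det_ublock det1 mulr1 -unitmxE.
rewrite tr_block_mx !mulmx_block.
rewrite !(mul0mx, mulmx0, mul1mx, mulmx1, mulmxN, mulNmx, oppr0, add0r,
  addr0, trmx0, trmx1).
by rewrite eP YE.
Qed.

Lemma exists_symplectic_representative g : SL g -> sigma_fixed g ->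
  exists2 k, GC k & Bor (invmx k *m g).
Proof.
move=> dg [db ub]; have ug := SL_unit dg.
have ugT : g^T \in unitmx by rewrite unitmx_tr.
set b := invmx g *m sigmaG g in db ub.
have bE : b *m E = invmx g *m E *m invmx g^T.
  by rewrite /b /sigmaG !mulmxA mulmxKV ?Emx_unit.
have sb : E *m b^T = b *m E.
  have /(congr1 trmx) := bE.
  by rewrite !trmx_mul Emx_tr -trmx_inv trmxK !(mulNmx, mulmxN) => /oppr_inj ->;
    rewrite bE mulmxA -trmx_inv.
have [c [uc unc cE]] := exists_upper_factor (SL_unit db) ub sb.
have kE : (g *m c) *m E *m (g *m c)^T = E.
  rewrite trmx_mul -!mulmxA (mulmxA c) (mulmxA (c *m E)) cE bE.
  by rewrite !mulmxA mulmxV // mul1mx mulmxKV.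
(* So far [c] is only known to be invertible; det (g c) = 1 = det g now forces det c = 1. *)
have dk := det_of_Emx_fixed kE.
exists (g *m c).
  by split => //; apply/sigmaG_fixedP => //; apply: SL_unit.
rewrite invmx_mul // mulmxKV //; apply: Bor_inv; split => //.
by move: dk; rewrite /SL det_mulmx dg mul1r.
Qed.

(** From g E g^T = E follow E g^T = g^-1 E and g^-T E = E g, which move g across [E]. *)
Lemma sigmaL_conj g x : GC g -> sigmaL x = x ->
  sigmaL (invmx g *m x *m g) = invmx g *m x *m g.
Proof.
move=> [dg sg] sx; have ug := SL_unit dg.
have ugT : g^T \in unitmx by rewrite unitmx_tr.
have gE := (sigmaG_fixedP ug).1 sg.
have e1 : E *m g^T = invmx g *m E by rewrite -{2}gE !mulmxA mulVmx // mul1mx.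
have e2 : invmx g^T *m E = E *m g.
  have /(congr1 trmx) := e1; rewrite !trmx_mul trmxK Emx_tr trmx_inv mulmxN mulNmx.
  move=> /oppr_inj /(congr1 (fun z => E *m z *m E)).
  by rewrite !mulmxA Emx_sqr -mulmxA Emx_sqr !mulNmx !mulmxN !mul1mx mulmx1
    => /oppr_inj.
rewrite /sigmaL !trmx_mul trmx_inv !mulmxA e1 -!mulmxA e2 !mulmxA.
by rewrite -[_ *m x^T *m E]mulmxA -[_ *m (x^T *m E)]mulmxA (mulmxA E) -/(sigmaL x) sx.
Qed.
End Sigma.

Arguments sgI {R n} i.

(** * Root vectors and coroots of the symplectic Lie algebra *)

Section Hessenberg.
Variables (R : realType) (n : nat).
Local Notation C := (R[i]).
Local Notation N := (n + n)%N.
Local Notation M := ('M[C]_N).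
Implicit Types (x y h : M) (i j k a b : 'I_N).

Lemma bracketDl x y z : bracket (x + y) z = bracket x z + bracket y z :> M.
Proof. by rewrite /bracket mulmxDl mulmxDr opprD addrACA. Qed.

Lemma bracketDr x y z : bracket z (x + y) = bracket z x + bracket z y :> M.
Proof. by rewrite /bracket mulmxDl mulmxDr opprD addrACA. Qed.

Lemma bracketZr c x y : bracket x (c *: y) = c *: bracket x y :> M.
Proof. by rewrite /bracket -scalemxAl -scalemxAr scalerBr. Qed.

Lemma bracketC x y : bracket x y = - bracket y x :> M.
Proof. by rewrite /bracket opprB. Qed.

Lemma sigmaL_bracket x y : sigmaL (bracket x y) = bracket (sigmaL x) (sigmaL y).
Proof.
have sM u v : sigmaL (u *m v) = - (sigmaL v *m sigmaL u) :> M.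
  rewrite /sigmaL trmx_mul !mulmxA.
  by rewrite -[X in - (X *m _ *m _)]mulmxA Emx_sqr mulmxN mulNmx mulNmx opprK mulmx1.
by rewrite /bracket -scaleN1r sigmaLD sigmaLZ !sM scaleN1r opprK addrC.
Qed.

Lemma bracket_diagE h x a b :
  diag h -> bracket h x a b = (h a a - h b b) * x a b.
Proof.
move=> dh; rewrite /bracket !mxE (bigD1 a) //= big1 ?addr0; last first.
  by move=> k ka; rewrite dh ?mul0r // eq_sym.
rewrite (bigD1 b) //= big1 ?addr0; last by move=> k kb; rewrite dh ?mulr0.
by rewrite mulrBl [x a b * _]mulrC.
Qed.

Lemma bracket_delta (i j k l : 'I_N) :
  bracket (delta_mx i j) (delta_mx k l) =
  (j == k)%:R *: delta_mx i l - (l == i)%:R *: delta_mx k j :> M.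
Proof. by rewrite /bracket !mul_delta_mx_cond !scaler_nat. Qed.

Lemma cartsig_fixed h : cartsig h -> sigmaL h = h.
Proof.
move=> [dh hh]; apply/matrixP => a b; rewrite sigmaLE.
have [<-|ab] := eqVneq a b; first by rewrite sgI_sqr mul1r [RHS]hh.
by rewrite !dh ?mulr0 ?oppr0 // (inj_eq rev_ord_inj) eq_sym.
Qed.

Lemma cartsigP h : diag h -> sigmaL h = h -> cartsig h.
Proof. by move=> dh sh; split=> // i; rewrite -{1}sh sigmaLE sgI_sqr mul1r. Qed.

Lemma cartsig_borC h : cartsig h -> borC h.
Proof.
move=> ch; have sh := cartsig_fixed ch; split=> //; split.
  exact: sl_of_sigma_fixed.
by case: ch => dh _ i j ji; rewrite dh // -val_eqE /= gtn_eqF.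
Qed.

(** For j = i' (a long root) sigma fixes E_ij, and the vector is 2 E_ij. *)
Definition rootvec i j : M := delta_mx i j + sigmaL (delta_mx i j).

Lemma rootvecE i j a b : rootvec i j a b =
  ((a == i) && (b == j))%:R
  - sgI a * sgI b * ((b == rev_ord i) && (a == rev_ord j))%:R.
Proof.
rewrite mxE mxE sigmaLE mxE (can2_eq rev_ordK rev_ordK).
by rewrite [rev_ord a == j](can2_eq rev_ordK rev_ordK).
Qed.

Lemma sigmaL_rootvec i j : sigmaL (rootvec i j) = rootvec i j.
Proof. by rewrite sigmaLD sigmaLK addrC. Qed.

Lemma sgIM_rev i : sgI i * sgI (rev_ord i) = -1 :> C.
Proof. by rewrite sgI_rev mulrN sgI_sqr. Qed.

Lemma rev_neq i : rev_ord i != i.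
Proof. by rewrite -val_eqE /=; have := ltn_ord i; lia. Qed.

Lemma rootvec_neq0 i j : rootvec i j i j != 0.
Proof.
rewrite rootvecE !eqxx /=; case: andP => [[/eqP-> _]|_].
  by rewrite sgIM_rev mulr1 opprK -[_ + _]/(2%:R : C) pnatr_eq0.
by rewrite mulr0 subr0 oner_eq0.
Qed.

Lemma sigmaL_delta i j :
  sigmaL (delta_mx i j) = - (sgI i * sgI j) *: delta_mx (rev_ord j) (rev_ord i) :> M.
Proof.
apply/matrixP => a b; rewrite sigmaLE !mxE.
rewrite (can2_eq rev_ordK rev_ordK) [rev_ord a == j](can2_eq rev_ordK rev_ordK).
case: eqP => [->|_]; case: eqP => [->|_]; rewrite /= ?mulr0 ?oppr0 //.
by rewrite !sgI_rev; ring.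
Qed.

Lemma rootspaceC_rootvec i j : rootspaceC i j (rootvec i j).
Proof.
have sx := sigmaL_rootvec i j; split.
  by split=> //; apply: sl_of_sigma_fixed.
move=> h [dh hh]; apply/matrixP => a b; rewrite bracket_diagE // [RHS]mxE rootvecE.
case: andP => [[/eqP-> /eqP->]|_] //; case: andP => [[/eqP-> /eqP->]|_]; last first.
  by rewrite mulr0 subr0 !mulr0.
by rewrite [h i i]hh [h j j]hh opprK /primeI; congr (_ * _); rewrite addrC.
Qed.

Lemma borC_rootvec i j : (i < j)%N -> borC (rootvec i j).
Proof.
move=> ij; have sx := sigmaL_rootvec i j; split=> //; split.
  exact: sl_of_sigma_fixed.
move=> a b ba; rewrite rootvecE.
case: andP => [[/eqP ai /eqP bj]|_]; first by subst; lia.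
case: andP => [[/eqP ai /eqP bj]|_]; last by rewrite mulr0 subr0.
by subst; move: ba => /=; have := ltn_ord i; have := ltn_ord j; lia.
Qed.

(** Since sigma respects brackets, the result is the symmetrization of a main term [D, D'] and a
    cross term [D, sigma D']. *)
Lemma bracket_rootvec_expand (D D' : M) :
  bracket (D + sigmaL D) (D' + sigmaL D') =
  (bracket D D' + sigmaL (bracket D D'))
  + (bracket D (sigmaL D') + sigmaL (bracket D (sigmaL D'))).
Proof.
rewrite !sigmaL_bracket sigmaLK bracketDl !bracketDr.
by rewrite [X in _ + X]addrC addrACA.
Qed.

(** The cross term vanishes unless i = j' or a = i', when one factor belongs to a long root. After
    symmetrization it then repeats the main term, so the coefficient is 1 or 2. *)
Lemma bracket_rootvec a i j : a != i -> a != j -> i != j ->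
  exists2 c : C, c != 0 & bracket (rootvec a i) (rootvec i j) = c *: rootvec a j.
Proof.
move=> ai aj ij; rewrite bracket_rootvec_expand.
rewrite bracket_delta eqxx [j == a]eq_sym (negbTE aj) scale1r scale0r subr0.
rewrite -/(rootvec a j).
rewrite sigmaL_delta bracketZr bracket_delta.
have two : 2%:R != 0 :> C by rewrite pnatr_eq0.
have [ij'|ij'] := eqVneq i (rev_ord j).
  have ji' : rev_ord i = j by rewrite ij' rev_ordK.
  exists 2%:R => //; rewrite ji' [j == a]eq_sym (negbTE aj) scale0r subr0 scale1r.
  rewrite -ji' sgIM_rev opprK scale1r ji' -/(rootvec a j).
  by rewrite scaler_nat mulr2n.
rewrite scale0r sub0r.
have [ia|ia] := eqVneq (rev_ord i) a; last first.
  exists 1; first exact: oner_neq0.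
  by rewrite scale0r oppr0 scaler0 -{2}(scale0r (0 : M)) sigmaLZ scale0r !addr0 scale1r.
exists 2%:R => //.
have -> : - (sgI i * sgI j) *: (- (1 *: delta_mx (rev_ord j) i)) =
    sigmaL (delta_mx a j) :> M.
  by rewrite sigmaL_delta -ia rev_ordK sgI_rev scale1r scalerN scaleNr opprK
    mulNr opprK.
by rewrite sigmaLK [sigmaL _ + _]addrC -/(rootvec a j) scaler_nat mulr2n.
Qed.

(** For i != j this is the coroot of the restricted root, doubled when j = i'. *)
Definition coroot i j : M := hmx R i j + sigmaL (hmx R i j).

Lemma corootN i j : coroot j i = - coroot i j.
Proof.
rewrite /coroot; have -> : hmx R j i = - hmx R i j :> M by rewrite /hmx opprB.
by rewrite -scaleN1r sigmaLZ -scalerDr scaleN1r.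
Qed.

Lemma bracket_rootvec_opp i j : i != j ->
  exists2 c : C, c != 0 & bracket (rootvec i j) (rootvec j i) = c *: coroot i j.
Proof.
move=> ij; rewrite bracket_rootvec_expand.
rewrite bracket_delta !eqxx !scale1r -/(hmx R i j) -/(coroot i j).
rewrite sigmaL_delta bracketZr bracket_delta.
have [ji'|ji'] := eqVneq j (rev_ord i).
  have ij' : rev_ord j = i by rewrite ji' rev_ordK.
  exists 2%:R; first by rewrite pnatr_eq0.
  rewrite ij' -ji' eqxx !scale1r mulrC ji' sgIM_rev opprK scale1r -ji' -/(hmx R i j).
  by rewrite -/(coroot i j) scaler_nat mulr2n.
exists 1; first exact: oner_neq0.
rewrite -[rev_ord j == i](inj_eq rev_ord_inj) rev_ordK (negbTE ji').
rewrite !scale0r subr0 scaler0.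
by rewrite -{2}(scale0r (0 : M)) sigmaLZ scale0r !addr0 scale1r.
Qed.

Lemma diag_hmx i j : diag (hmx R i j : M).
Proof.
move=> a b ab; rewrite !mxE.
by case: eqP => [<-|_]; rewrite ?[b == a]eq_sym ?(negbTE ab) /=;
  case: eqP => [<-|_]; rewrite ?[b == a]eq_sym ?(negbTE ab) /= subrr.
Qed.

Lemma hmxE i j a : hmx R i j a a = (a == i)%:R - (a == j)%:R :> C.
Proof. by rewrite !mxE !andbb. Qed.

Lemma cartsig_coroot i j : cartsig (coroot i j).
Proof.
apply: cartsigP; last by rewrite /coroot sigmaLD sigmaLK addrC.
move=> a b ab; rewrite mxE sigmaLE !diag_hmx ?mulr0 ?oppr0 ?addr0 //.
by rewrite (inj_eq rev_ord_inj) eq_sym.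
Qed.

Lemma corootE i j a : coroot i j a a =
  (a == i)%:R - (a == j)%:R - (a == rev_ord i)%:R + (a == rev_ord j)%:R.
Proof.
rewrite mxE sigmaLE sgI_sqr mul1r !hmxE.
rewrite (can2_eq rev_ordK rev_ordK) [rev_ord a == j](can2_eq rev_ordK rev_ordK).
by ring.
Qed.

(** The value is 2, or 4 in the doubled case j = i'. *)
Lemma coroot_root_neq0 i j : i != j -> coroot i j i i - coroot i j j j != 0.
Proof.
move=> ij; have ji : j == i = false by rewrite eq_sym (negbTE ij).
have rF k : k == rev_ord k = false by rewrite eq_sym (negbTE (rev_neq k)).
have ijr : (j == rev_ord i) = (i == rev_ord j).
  by rewrite -(can2_eq rev_ordK rev_ordK) eq_sym.
rewrite !corootE !eqxx (negbTE ij) ji !rF ijr; case: (i == rev_ord j) => /=.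
  by rewrite [X in X != _](_ : _ = 4%:R) ?pnatr_eq0 //; ring.
by rewrite [X in X != _](_ : _ = 2%:R) ?pnatr_eq0 //; ring.
Qed.

(** * Weights of h^sigma on matrix positions *)

Definition diagpart x : M := \matrix_(a, b) (if a == b then x a b else 0).

(** This is one-dimensionality of root spaces: two positions share a nonzero weight only if they
    agree or are exchanged by the antidiagonal reflection. Evaluating at k = i and k = j
    suffices. *)
Lemma same_weight_cases i j a b : i != j ->
  (forall k, hmx R k (rev_ord k) a a - hmx R k (rev_ord k) b b
     = hmx R k (rev_ord k) i i - hmx R k (rev_ord k) j j :> C) ->
  (a = i /\ b = j) \/ (a = rev_ord j /\ b = rev_ord i).
Proof.
move=> ij hw.
(* Moving the negative terms across turns the weight equation into an identity of natural numbers,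
   which a case analysis decides. *)
have hn k : ((a == k) + (b == rev_ord k) + (i == rev_ord k) + (j == k) =
   (b == k) + (a == rev_ord k) + (i == k) + (j == rev_ord k))%N.
  have := hw k; rewrite !hmxE => e; apply/eqP; rewrite -(eqr_nat C) !natrD.
  apply/eqP/subr0_eq; move/eqP: e; rewrite -subr_eq0 => /eqP <-; ring.
have ji : j == i = false by rewrite eq_sym (negbTE ij).
have rF k : k == rev_ord k = false by rewrite eq_sym (negbTE (rev_neq k)).
have jir : (j == rev_ord i) = (i == rev_ord j).
  by rewrite -(can2_eq rev_ordK rev_ordK) eq_sym.
move: (hn i) (hn j); rewrite !eqxx ji (negbTE ij) !rF jir => {hn hw}.
have [->|ai] := eqVneq a i.
  have [->|bj] := eqVneq b j; first by left.
  by move=> _; rewrite (negbTE ij); case: (b == _); case: (i == _).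
have [->|bi] := eqVneq b (rev_ord i); last first.
  by case: (b == i); case: (a == _); case: (i == _).
have [->|aj] := eqVneq a (rev_ord j); first by right.
have -> : rev_ord i == j = (i == rev_ord j) by rewrite (can2_eq rev_ordK rev_ordK).
case: (i == rev_ord j); first by case: (rev_ord i == i); case: (a == _).
by move=> _; case: (a == j); case: (rev_ord i == _).
Qed.

Lemma same_weight_diag a b :
  (forall k, hmx R k (rev_ord k) a a - hmx R k (rev_ord k) b b = 0 :> C) -> a = b.
Proof.
move=> hw; have := hw a; rewrite !hmxE eqxx [a == rev_ord a]eq_sym (negbTE (rev_neq a)).
rewrite [b == a]eq_sym; have [//|_] := eqVneq a b.
rewrite subr0 sub0r opprK => /eqP; case: (b == _); rewrite ?addr0 ?oner_eq0 //.
by rewrite -[_ + _]/(2%:R : C) pnatr_eq0.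
Qed.

End Hessenberg.

(** * Weight decomposition of a type C Hessenberg space *)

Section TypeCHessenberg.
Variables (R : realType) (n : nat).
Local Notation C := (R[i]).
Local Notation N := (n + n)%N.
Local Notation M := ('M[C]_N).
Implicit Types (x y h d : M) (i j k a b : 'I_N).
Variable HC : M -> Prop.
Hypothesis hHC : hessC HC.

Let HC0 : HC 0. Proof. by case: hHC => -[]. Qed.
Let HCD x y : HC x -> HC y -> HC (x + y).
Proof. by case: hHC => -[_ [+ _] _]; apply. Qed.
Let HCZ c x : HC x -> HC (c *: x).
Proof. by case: hHC => -[_ [_ +] _]; apply. Qed.
Let HCgC x : HC x -> gC x.
Proof. by case: hHC => _ [+ _]; apply. Qed.
Let HCb y x : borC y -> HC x -> HC (bracket y x).
Proof. by case: hHC => _ [_ +]; apply. Qed.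

Lemma HC_sum (I : finType) (f : I -> M) : (forall t, HC (f t)) -> HC (\sum_t f t).
Proof. by move=> Hf; elim/big_rec: _ => // k x _ Hx; apply: HCD. Qed.

Lemma HC_scale_cancel c x : c != 0 -> HC (c *: x) -> HC x.
Proof. by move=> c0 /(HCZ c^-1); rewrite scalerA mulVf // scale1r. Qed.

(** Lagrange interpolation in ad h: the product of ad h - m over the other weights m kills their
    components and scales the one of weight [l] by a nonzero constant. *)
Lemma HC_weight_proj h (l : C) x : cartsig h -> HC x ->
  HC (\matrix_(a, b) (if h a a - h b b == l then x a b else 0)).
Proof.
move=> ch Hx; have [dh _] := ch.
have Hs (s : seq C) :
    HC (\matrix_(a, b) (\prod_(m <- s) (h a a - h b b - m) * x a b)).
  elim: s => [|m s IHs].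
    have -> // : \matrix_(a, b) (\prod_(m <- [::]) (h a a - h b b - m) * x a b) = x.
    by apply/matrixP => a b; rewrite mxE big_nil mul1r.
  set z := \matrix_(a, b) _ in IHs.
  have -> : \matrix_(a, b) (\prod_(m <- m :: s) (h a a - h b b - m) * x a b) =
      bracket h z + (- m) *: z.
    apply/matrixP => a b; rewrite mxE big_cons [RHS]mxE bracket_diagE //.
    rewrite [(_ *: z) a b]mxE.
    by rewrite [z a b]mxE; ring.
  by apply: HCD; [apply: HCb => //; exact: cartsig_borC | exact: HCZ].
pose s := [seq m <- [seq h p.1 p.1 - h p.2 p.2 | p : 'I_N * 'I_N] | m != l].
have pl0 : \prod_(m <- s) (l - m) != 0.
  rewrite prodf_seq_neq0; apply/allP => m; rewrite mem_filter => /andP [ml _] /=.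
  by rewrite subr_eq0 eq_sym.
apply: (HC_scale_cancel pl0).
have -> // : \prod_(m <- s) (l - m) *:
    (\matrix_(a, b) (if h a a - h b b == l then x a b else 0)) =
  \matrix_(a, b) (\prod_(m <- s) (h a a - h b b - m) * x a b).
apply/matrixP => a b; rewrite !mxE; case: eqP => [->//|/eqP hl].
rewrite mulr0 (big_rem (h a a - h b b)) /=; first by rewrite subrr !mul0r.
by rewrite mem_filter hl /=; apply/imageP; exists (a, b).
Qed.

Lemma cartsig_hmx k : cartsig (hmx R k (rev_ord k)).
Proof.
split; first exact: diag_hmx.
move=> i; rewrite /primeI !hmxE (inj_eq rev_ord_inj).
by rewrite (can2_eq rev_ordK rev_ordK) opprB.
Qed.

(** Projecting successively for each h_kk' isolates a joint weight of h^sigma. *)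
Lemma HC_root_proj (l : 'I_N -> C) x : HC x ->
  HC (\matrix_(a, b)
        (if [forall k, hmx R k (rev_ord k) a a - hmx R k (rev_ord k) b b == l k]
         then x a b else 0)).
Proof.
move=> Hx.
have Hs (s : seq 'I_N) : HC (\matrix_(a, b)
      (if all (fun k => hmx R k (rev_ord k) a a - hmx R k (rev_ord k) b b == l k) s
       then x a b else 0)).
  elim: s => [|k s IHs].
    by have -> // : \matrix_(a, b) x a b = x; apply/matrixP => a b; rewrite mxE.
  set z := (\matrix_(a, b) _) in IHs.
  have := HC_weight_proj (l k) (cartsig_hmx k) IHs.
  congr HC; apply/matrixP => a b; rewrite [LHS]mxE [RHS]mxE [z a b]mxE /=.
  by case: eqP.
have := Hs (enum 'I_N); congr HC; apply/matrixP => a b; rewrite [LHS]mxE [RHS]mxE.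
congr (if _ then _ else _); apply/allP/forallP => [hk k|hk k _]; last exact: hk.
by apply: hk; rewrite mem_enum.
Qed.

(** The projection [z] of [x] to the weight of (i, j) is nonzero, and the root space is a line, so
    every [y] in it is the multiple y_ij / x_ij of [z]. *)
Lemma PhiH_of_entry x i j : i != j -> HC x -> x i j != 0 -> PhiH HC i j.
Proof.
move=> ij Hx xij; split=> // y [[_ sy] wy].
have := HC_root_proj
  (fun k => hmx R k (rev_ord k) i i - hmx R k (rev_ord k) j j) Hx.
set z := (\matrix_(a, b) _) => Hz.
have [_ sz] := HCgC Hz.
have zij : z i j = x i j by rewrite mxE; case: forallP => // -[] k.
have supp (w : M) a b : (forall k, w a b != 0 -> 
    hmx R k (rev_ord k) a a - hmx R k (rev_ord k) b b
     = hmx R k (rev_ord k) i i - hmx R k (rev_ord k) j j) ->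
  w a b = 0 \/ (a = i /\ b = j) \/ (a = rev_ord j /\ b = rev_ord i).
  move=> hw; have [->|w0] := eqVneq (w a b) 0; first by left.
  by right; apply: (same_weight_cases (R := R) ij) => k; apply: hw.
have -> : y = (y i j / x i j) *: z; last exact: HCZ.
(* A sigma-fixed matrix has its (j', i') entry determined by its (i, j) entry. *)
have rel w : sigmaL w = w -> w (rev_ord j) (rev_ord i) = - (sgI i * sgI j * w i j) :> C.
  by move=> {1}<-; rewrite sigmaLE !rev_ordK !sgI_rev; ring.
apply/matrixP => a b; rewrite [RHS]mxE.
have eij : y i j = y i j / x i j * z i j by rewrite zij divfK.
have eji : y (rev_ord j) (rev_ord i) = y i j / x i j * z (rev_ord j) (rev_ord i).
  by rewrite !rel // {1}eij; ring.
case: (supp y a b) => [k|ya|[[-> ->]|[-> ->]]] //.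
  have /matrixP/(_ a b) := wy _ (cartsig_hmx k).
  rewrite bracket_diagE; last exact: diag_hmx.
  by rewrite [RHS]mxE => + y0; apply: mulIf.
case: (supp z a b) => [k|->|[[-> ->]|[-> ->]]] //; last by rewrite ya mulr0.
by rewrite [z a b]mxE; case: forallP => [/(_ k)/eqP //|]; rewrite eqxx.
Qed.

(** * Closure properties of Phi_H *)

Lemma HC_rootvec i j : PhiH HC i j -> HC (rootvec R i j).
Proof. by case=> _; apply; exact: rootspaceC_rootvec. Qed.

Lemma PhiHP i j : i != j -> PhiH HC i j <-> HC (rootvec R i j).
Proof.
move=> ij; split; first exact: HC_rootvec.
by move=> /(PhiH_of_entry ij); apply; exact: rootvec_neq0.
Qed.

Lemma PhiH_rev i j : PhiH HC i j -> PhiH HC (rev_ord j) (rev_ord i).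
Proof.
move=> Pij; have [ij _] := Pij; have Hr := HC_rootvec Pij.
apply: (PhiH_of_entry _ Hr); first by rewrite (inj_eq rev_ord_inj) eq_sym.
apply: contraNneq (rootvec_neq0 R i j) => e.
by rewrite -sigmaL_rootvec sigmaLE e mulr0 oppr0.
Qed.

(** The root vector at (a, i) lies in b_C, and bracketing with it moves (i, j) to (a, j). *)
Lemma PhiH_up i j a : PhiH HC i j -> (a < i)%N -> a != j -> PhiH HC a j.
Proof.
move=> Pij ai aj; have [ij _] := Pij; apply/PhiHP => //.
have ai' : a != i by rewrite -val_eqE /= ltn_eqF.
have [c c0 e] := bracket_rootvec R ai' aj ij.
apply: (HC_scale_cancel c0); rewrite -e.
by apply: HCb; [exact: borC_rootvec|exact: HC_rootvec].
Qed.

(** The antidiagonal reflection exchanges moves to the right with moves up. *)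
Lemma PhiH_right i j b : PhiH HC i j -> (j < b)%N -> b != i -> PhiH HC i b.
Proof.
move=> /PhiH_rev Pij jb bi; rewrite -(rev_ordK i) -(rev_ordK b); apply: PhiH_rev.
apply: (PhiH_up Pij); last by rewrite (inj_eq rev_ord_inj).
by move=> /=; have := ltn_ord b; lia.
Qed.

Lemma HC_coroot_of_neg i j : PhiH HC i j -> (j < i)%N -> HC (coroot R j i).
Proof.
move=> Pij ji; have ji' : j != i by rewrite -val_eqE /= ltn_eqF.
have [c c0 e] := bracket_rootvec_opp R ji'.
apply: (HC_scale_cancel c0); rewrite -e.
by apply: HCb; [exact: borC_rootvec|exact: HC_rootvec].
Qed.

Lemma PhiH_of_cartsig d i j : HC d -> diag d -> (i < j)%N ->
  d i i != d j j -> PhiH HC i j.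
Proof.
move=> Hd dd ij dij; have ij' : i != j by rewrite -val_eqE /= ltn_eqF.
apply: (PhiH_of_entry ij' (HCb (borC_rootvec R ij) Hd)).
rewrite bracketC mxE bracket_diagE // oppr_eq0 mulf_neq0 ?rootvec_neq0 //.
by rewrite subr_eq0.
Qed.

(** An sl_2 argument: bracketing twice with the positive root vector leads from the negative root
    vector to the coroot, then to the positive root vector, since the root is nonzero on its
    coroot. *)
Lemma PhiH_flip i j : PhiH HC i j -> (j < i)%N -> PhiH HC j i.
Proof.
move=> Pij ji; have ji' : j != i by rewrite -val_eqE /= ltn_eqF.
have [dd _] := cartsig_coroot R j i.
apply: (PhiH_of_cartsig (HC_coroot_of_neg Pij ji) dd ji).
by rewrite -subr_eq0 coroot_root_neq0.
Qed.

Lemma HC_coroot i j : PhiH HC i j -> PhiH HC j i -> HC (coroot R i j).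
Proof.
move=> Pij Pji; have [ij _] := Pij; case: (ltngtP i j) => [lij|lji|/val_inj e].
- exact: HC_coroot_of_neg.
- by rewrite corootN -scaleN1r; apply/HCZ/HC_coroot_of_neg.
- by rewrite e eqxx in ij.
Qed.

Lemma PhiH_of_hmx k l a b : PhiH HC k l -> PhiH HC l k -> (a < b)%N ->
  hmx R k l a a - hmx R k l b b != 0 -> PhiH HC a b.
Proof.
move=> Pkl Plk ab.
(* If h_kl has different entries at a and b, then {a, b} meets {k, l}. From (p, q) and (q, p) with p
   in {a, b}, a move up or right reaches (a, b) or (b, a), and a flip handles the latter. *)
have half p q : PhiH HC p q -> PhiH HC q p -> (a == p) || (b == p) -> PhiH HC a b.
  move=> Ppq Pqp /orP [/eqP ap|/eqP bp].
    subst p; case: (ltngtP b q) => [bq|qb|/val_inj ->] //.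
      have Pba : PhiH HC b a by apply: (PhiH_up Pqp) => //; rewrite -val_eqE /= gtn_eqF.
      exact: PhiH_flip.
    by apply: (PhiH_right Ppq) => //; rewrite -val_eqE /= gtn_eqF.
  subst p; case: (ltngtP a q) => [aq|qa|/val_inj ->] //.
    by apply: (PhiH_up Pqp) => //; rewrite -val_eqE /= ltn_eqF.
  have Pba : PhiH HC b a by apply: (PhiH_right Ppq) => //; rewrite -val_eqE /= ltn_eqF.
  exact: PhiH_flip.
rewrite !hmxE => h.
have [e|e] := boolP ((a == k) || (b == k)); first exact: (half k l).
have [e'|e'] := boolP ((a == l) || (b == l)); first exact: (half l k).
move: e e' h; rewrite !negb_or => /andP [/negbTE-> /negbTE->]
  /andP [/negbTE-> /negbTE->].
by rewrite !subrr eqxx.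
Qed.

(** * The Cartan part of H *)

Lemma diag_Hcart d : Hcart HC d -> diag d.
Proof.
move=> [d0 [c [[_ [dd _]] [_ ->]]]] a b ab; rewrite mxE dd // add0r.
rewrite summxE big1 // => k _; rewrite summxE big1 // => l _.
by rewrite mxE diag_hmx ?mulr0.
Qed.

(** By contraposition: if (a, b) is not in Phi_H, every generator of the Cartan part has equal
    entries at a and b. *)
Lemma PhiH_of_Hcart d a b : Hcart HC d -> (a < b)%N -> d a a != d b b -> PhiH HC a b.
Proof.
move=> [d0 [c [[Hd0 [dd _]] [hc ->]]]] ab; apply: contraPP => nP; apply/negP.
rewrite negbK !mxE; have -> : d0 a a = d0 b b.
  by apply/eqP/negPn/negP => /(PhiH_of_cartsig Hd0 dd ab).
rewrite !summxE; apply/eqP; congr (_ + _); apply: eq_bigr => k _.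
rewrite !summxE; apply: eq_bigr => l _; rewrite mxE [RHS]mxE.
have [[Pk Pl]|nPP] := boolp.pselect (PhiH HC k l /\ PhiH HC l k); last first.
  by rewrite hc // !mul0r.
congr (_ * _); apply/eqP; rewrite -subr_eq0.
by apply/negPn/negP => /(PhiH_of_hmx Pk Pl ab).
Qed.

Lemma Hcart_of_HC d : HC d -> cartsig d -> Hcart HC d.
Proof.
move=> Hd cd; exists d, (fun _ _ => 0); split=> //; split=> //.
by rewrite big1 ?addr0 // => k _; rewrite big1 // => l _; rewrite scale0r.
Qed.

Lemma cartsig0 : cartsig (0 : M).
Proof. by split=> [a b _|a]; rewrite !mxE ?oppr0. Qed.

Lemma Hcart_sum_hmx (c : 'I_N -> 'I_N -> C) :
  (forall i j, c i j != 0 -> PhiH HC i j /\ PhiH HC j i) ->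
  Hcart HC (\sum_i \sum_j c i j *: hmx R i j).
Proof.
move=> hc; exists 0, c; split; first by split=> //; exact: cartsig0.
split; last by rewrite add0r.
by move=> i j nP; apply/eqP/negPn/negP => /hc.
Qed.

Lemma HcartD d d' : Hcart HC d -> Hcart HC d' -> Hcart HC (d + d').
Proof.
move=> [d0 [c [[Hd [dd sd]] [hc ->]]]] [d0' [c' [[Hd' [dd' sd']] [hc' ->]]]].
exists (d0 + d0'), (fun i j => c i j + c' i j); split.
  split; first exact: HCD.
  split=> [a b ab|a]; first by rewrite mxE dd ?dd' ?addr0.
  by rewrite !mxE sd sd' opprD.
split=> [i j nP|]; first by rewrite hc ?hc' ?addr0.
rewrite addrACA -big_split; congr (_ + _); apply: eq_bigr => k _ /=.
by rewrite -big_split; apply: eq_bigr => l _; rewrite scalerDl.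
Qed.

Lemma HcartZ (e : C) d : Hcart HC d -> Hcart HC (e *: d).
Proof.
move=> [d0 [c [[Hd [dd sd]] [hc ->]]]].
exists (e *: d0), (fun i j => e * c i j); split.
  split; first exact: HCZ.
  split=> [a b ab|a]; first by rewrite mxE dd ?mulr0.
  by rewrite !mxE sd mulrN.
split=> [i j nP|]; first by rewrite hc ?mulr0.
rewrite scalerDr scaler_sumr; congr (_ + _); apply: eq_bigr => k _.
by rewrite scaler_sumr; apply: eq_bigr => l _; rewrite scalerA.
Qed.

(** * Entrywise description of H and stability under brackets *)

Lemma sum_delta (c : 'I_N -> 'I_N -> C) :
  \sum_i \sum_j c i j *: delta_mx i j = \matrix_(i, j) c i j :> M.
Proof.
rewrite [RHS]matrix_sum_delta; apply: eq_bigr => i _.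
by apply: eq_bigr => j _; rewrite mxE.
Qed.

(** The off-diagonal coefficients can be read off as entries of [x]; the diagonal ones vanish
    because Phi_H only contains pairs i != j. *)
Lemma HofP x : Hof HC x <->
  (forall a b, a != b -> x a b != 0 -> PhiH HC a b) /\ Hcart HC (diagpart x).
Proof.
split.
  move=> [d [c [Hd [hc ->]]]]; rewrite sum_delta; have dd := diag_Hcart Hd; split.
    move=> a b ab; rewrite !mxE dd // add0r => cab; apply: boolp.contrapT => /hc.
    by apply/eqP.
  rewrite [diagpart _](_ : _ = d) //; apply/matrixP => a b; rewrite !mxE.
  case: eqVneq => [<-|/dd ->] //; rewrite hc ?addr0 //.
  by case; rewrite eqxx.
move=> [hx Hd]; exists (diagpart x), (fun a b => if a == b then 0 else x a b).
split=> //; split.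
  move=> a b nP; case: eqVneq => // ab.
  by apply/eqP/negPn/negP => /(hx _ _ ab).
rewrite sum_delta; apply/matrixP => a b; rewrite !mxE.
by case: eqP; rewrite ?addr0 ?add0r.
Qed.

Lemma diagpartD x y : diagpart (x + y) = diagpart x + diagpart y.
Proof. by apply/matrixP => a b; rewrite !mxE; case: eqP; rewrite ?addr0. Qed.

Lemma diagpartZ c x : diagpart (c *: x) = c *: diagpart x.
Proof. by apply/matrixP => a b; rewrite !mxE; case: eqP; rewrite ?mulr0. Qed.

Lemma subspace_Hof : subspace (Hof HC).
Proof.
split; [|split].
- apply/HofP; split=> [a b _|]; first by rewrite mxE eqxx.
  rewrite [diagpart _](_ : _ = 0); first by apply: Hcart_of_HC; [|exact: cartsig0].
  by apply/matrixP => a b; rewrite !mxE if_same.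
- move=> x y /HofP [hx dx] /HofP [hy dy]; apply/HofP; split; last first.
    by rewrite diagpartD; exact: HcartD.
  move=> a b ab; rewrite mxE; have [->|xab _] := eqVneq (x a b) 0; last exact: hx.
  by rewrite add0r; exact: hy.
- move=> c x /HofP [hx dx]; apply/HofP; split; last first.
    by rewrite diagpartZ; exact: HcartZ.
  by move=> a b ab; rewrite mxE mulf_eq0 negb_or => /andP [_]; exact: hx.
Qed.

Lemma sl_Hof x : Hof HC x -> sl x.
Proof.
move=> /HofP [_ [d0 [c [[Hd _] [_ e]]]]].
have -> : sl x = sl (diagpart x).
  by rewrite /sl; congr (_ = _); apply: eq_bigr => i _; rewrite mxE eqxx.
have [d00 _] := HCgC Hd.
rewrite e /sl linearD /= d00 add0r linear_sum big1 // => k _.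
rewrite linear_sum big1 // => l _ /=.
have tr1 i : \tr (delta_mx i i : M) = 1.
  rewrite /mxtrace (bigD1 i) //= big1 ?mxE ?eqxx ?addr0 // => j ji.
  by rewrite mxE (negbTE ji).
by rewrite linearZ /= linearB /= !tr1 subrr mulr0.
Qed.

(** Stated for all upper triangular [y]: these are closed under products, as [conj_closed] requires,
    whereas traceless ones are not. *)
Lemma Hof_bracket y x : upper y -> Hof HC x -> Hof HC (bracket y x).
Proof.
move=> uy /HofP [hx dx]; apply/HofP; split.
  move=> a b ab z0; apply: boolp.contrapT => nP; move/negP: z0; apply.
  have xab : x a b = 0 by apply/eqP/negPn/negP => /(hx _ _ ab).
  have ba : b != a by rewrite eq_sym.
  (* The terms k = a and k = b are split off. If (a, b) is not in Phi_H, a nonzero y_ak x_kb with k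
     > a would put it there by a move up, and a nonzero x_ak y_kb with k < b by a move right. *)
  rewrite !mxE (bigD1 b) //= (bigD1 a) //= big1; last first.
    move=> k /andP [kb ka]; have [ak|ak] := ltnP a k; last first.
      rewrite uy ?mul0r // ltn_neqAle ak andbT; exact: ka.
    apply/eqP; rewrite mulf_eq0; apply/orP; right; apply/negPn/negP => xkb.
    exact: nP (PhiH_up (hx _ _ kb xkb) ak ab).
  rewrite [X in _ - X](bigD1 a) //= [X in _ - (_ + X)](bigD1 b) //=.
  rewrite [X in _ - (_ + (_ + X))]big1; last first.
    move=> k /andP [ka kb]; have [kb'|bk] := ltnP k b; last first.
      rewrite uy ?mulr0 // ltn_neqAle bk andbT eq_sym; exact: kb.
    apply/eqP; rewrite mulf_eq0; apply/orP; left; apply/negPn/negP => xak.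
    have ak : a != k by rewrite eq_sym.
    exact: nP (PhiH_right (hx _ _ ak xak) kb' ba).
  rewrite xab mulr0 mul0r !addr0 [x a a * _]mulrC -mulrBr.
  (* What remains is y_ab (x_bb - x_aa), controlled by the Cartan part of [x]. *)
  have [lab|lba] := ltnP a b; last first.
    by rewrite uy ?mul0r // ltn_neqAle lba andbT; exact: ba.
  rewrite mulf_eq0 subr_eq0; apply/orP; right; rewrite eq_sym; apply/negPn/negP => xx.
  by apply/nP/(PhiH_of_Hcart dx lab); rewrite !mxE !eqxx.
(* For a < k the product y_ak x_ka enters the diagonal of the bracket with sign + at a and - at k,
   that is, as a coefficient of h_ak. *)
pose c a k := if (a < k)%N then y a k * x k a else 0.
have -> : diagpart (bracket y x) = \sum_a \sum_k c a k *: hmx R a k.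
  apply/matrixP => p q; rewrite summxE mxE; have [<-|pq] := eqVneq p q; last first.
    rewrite big1 // => a _; rewrite summxE big1 // => k _.
    by rewrite mxE diag_hmx ?mulr0.
  have -> : \sum_a (\sum_k c a k *: hmx R a k) p p =
      \sum_a \sum_k c a k * (p == a)%:R - \sum_a \sum_k c a k * (p == k)%:R.
    rewrite -sumrB; apply: eq_bigr => a _; rewrite summxE -sumrB.
    by apply: eq_bigr => k _; rewrite mxE hmxE mulrBr.
  rewrite !mxE; rewrite (bigD1 p) //= [X in _ - X](bigD1 p) //=.
  rewrite [x p p * _]mulrC opprD addrACA subrr add0r; congr (_ - _).
    rewrite [RHS](bigD1 p) //= [X in _ + X]big1 ?addr0 => [|a ap]; last first.
      by rewrite big1 // => k _; rewrite eq_sym (negbTE ap) mulr0.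
    rewrite [RHS](bigD1 p) //= /c ltnn mul0r add0r; apply: eq_bigr => k kp.
    rewrite eqxx mulr1; case: ltnP => // kp'.
    by rewrite uy ?mul0r // ltn_neqAle kp' andbT.
  rewrite exchange_big [RHS](bigD1 p) //= [X in _ + X]big1 ?addr0; last first.
    by move=> a ap; rewrite big1 // => k _; rewrite eq_sym (negbTE ap) mulr0.
  rewrite [RHS](bigD1 p) //= /c ltnn mul0r add0r; apply: eq_bigr => k kp.
  rewrite eqxx mulr1 mulrC; case: ltnP => // kp'.
  by rewrite uy ?mul0r // ltn_neqAle kp' andbT eq_sym.
apply: Hcart_sum_hmx => a k; rewrite /c; case: ltnP; rewrite ?eqxx // => ak.
rewrite mulf_eq0 negb_or => /andP [_ xka].
have ka : k != a by rewrite -val_eqE /= gtn_eqF.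
have Pka := hx _ _ ka xka; split=> //; exact: PhiH_flip.
Qed.

(** * Fixed points of H and conjugation by B *)

Lemma HC_diagpart x : HC x -> HC (diagpart x).
Proof.
(* The diagonal part is the component of weight 0. *)
move=> /(HC_root_proj (fun=> 0)); congr HC; apply/matrixP => a b.
rewrite [LHS]mxE [RHS]mxE; case: eqVneq => [->|ab].
  by case: forallP => // -[] k; rewrite subrr.
case: forallP => // h; case/eqP: ab.
by apply: (same_weight_diag (R := R)) => k; exact/eqP.
Qed.

Lemma Hof_of_HC x : HC x -> Hof HC x.
Proof.
move=> Hx; apply/HofP; split=> [a b ab|]; first exact: PhiH_of_entry.
have Hd := HC_diagpart Hx; have [_ sd] := HCgC Hd.
apply: Hcart_of_HC => //; apply: cartsigP => // a b ab.
by rewrite mxE (negbTE ab).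
Qed.

Lemma sigmaL_sum (I : finType) (f : I -> M) : sigmaL (\sum_t f t) = \sum_t sigmaL (f t).
Proof.
apply: (big_morph (@sigmaL R n)); first exact: sigmaLD.
by have := sigmaLZ 0 (0 : M); rewrite !scale0r.
Qed.

(** Write 2x = x + sigma(x): symmetrization sends h_ij to a coroot, E_ij to a root vector, and
    doubles the part already in H_C. *)
Lemma HC_of_Hof x : Hof HC x -> sigmaL x = x -> HC x.
Proof.
move=> [d [c [[d0 [e [[Hd0 cd0] [he ->]]]] [hc ->]]]] sx.
apply: (@HC_scale_cancel 2%:R); first by rewrite pnatr_eq0.
rewrite scaler_nat mulr2n -{2}sx !sigmaLD !sigmaL_sum (cartsig_fixed cd0).
rewrite !(addrACA _ (\sum_i _)) -!big_split.
apply: HCD; first (apply: HCD; first exact: HCD).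
  apply: HC_sum => i; rewrite sigmaL_sum -big_split; apply: HC_sum => j /=.
  rewrite sigmaLZ -scalerDr -/(coroot R i j).
  have [[P Q]|nP] := boolp.pselect (PhiH HC i j /\ PhiH HC j i); last first.
    by rewrite he // scale0r.
  by apply/HCZ/HC_coroot.
apply: HC_sum => i; rewrite sigmaL_sum -big_split; apply: HC_sum => j /=.
rewrite sigmaLZ -scalerDr -/(rootvec R i j).
have [P|nP] := boolp.pselect (PhiH HC i j); last by rewrite hc // scale0r.
by apply/HCZ/HC_rootvec.
Qed.

Lemma Hof_conj (b x : M) : Bor b -> Hof HC x -> Hof HC (invmx b *m x *m b).
Proof.
move=> /Bor_inv [db ub] Hx; have [H0 [HD HZ]] := subspace_Hof.
have := @conj_closed _ _ (Hof HC) (@upper R n) H0 HD HZ.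
move=> /(_ (upper_scalar_mx 1) (@upper_mul R n) Hof_bracket _ _ (SL_unit db) ub Hx).
by rewrite invmxK.
Qed.

End TypeCHessenberg.

Theorem theorem1p12 (R : realType) (n : nat)
    (HC : 'M[R[i]]_(n + n) -> Prop) :
  hessC HC ->
  (* (1) H is a type A Hessenberg space and H^sigma = H_C *)
  (hessA (Hof HC) /\
   forall x, (Hof HC x /\ sigmaL x = x) <-> HC x) /\
  (* (2) phi'(B_C(x, H_C)) = B_A(x, H)^sigma, as sets of points gB *)
  (forall x, gC x ->
   forall g, SL g ->
     (in_phiBC x HC g <-> (in_BA x (Hof HC) g /\ sigma_fixed g))).
Proof.
move=> hHC; split.
  split.
    split; first exact: subspace_Hof.
    split=> [x|y x [_ uy]]; first exact: sl_Hof.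
    exact: Hof_bracket.
  move=> x; split=> [[Hx sx]|Hx]; first exact: HC_of_Hof.
  split; first exact: Hof_of_HC.
  by case: hHC => _ [+ _] => /(_ x Hx) [].
move=> x [_ sx] g dg; have ug := SL_unit dg; split.
  move=> [k [[dk sk] [Hk Bk]]]; have uk := SL_unit dk; split.
    by exists k; split=> //; split=> //; apply: Hof_of_HC.
  (* With g = k b and sigma(k) = k, g^-1 sigma(g) = b^-1 sigma(b), and B is sigma-stable. *)
  have gE : g = k *m (invmx k *m g) by rewrite mulKVmx.
  have uB := SL_unit Bk.1.
  rewrite /sigma_fixed.
  have -> : invmx g *m sigmaG g = invmx (invmx k *m g) *m sigmaG (invmx k *m g).
    by rewrite {1 2}gE sigmaG_mul // sk invmx_mul // -mulmxA mulKmx.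
  by apply: Bor_mul; [exact: Bor_inv|exact: Bor_sigmaG].
move=> [[g' [dg' [Bg' Hg']]] sg].
have [k GCk Bk] := exists_symplectic_representative dg sg.
have [dk _] := GCk; have uk := SL_unit dk; have ug' := SL_unit dg'.
exists k; split=> //; split=> //; apply: (HC_of_Hof hHC); last exact: sigmaL_conj.
(* [g'] and [k] represent the same flag, so they differ by an element of B, and conjugation by it
   preserves H. *)
have Bb : Bor (invmx g' *m k).
  have := Bor_mul Bg' (Bor_inv Bk); rewrite invmx_mul ?invmxK ?unitmx_inv //.
  by rewrite !mulmxA mulmxK.
have := Hof_conj hHC Bb Hg'; congr (Hof HC _).
by rewrite invmx_mul ?unitmx_inv // invmxK !mulmxA !mulmxK.
Qed.
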